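(* Let $\Bbbk$ be any field and $\alpha,\beta,\gamma\in\Bbbk$. If $\{\alpha,\beta,\gamma\}\cap\{0,\pm1\}=\varnothing$ and $\alpha+\beta+\gamma+\alpha\beta\gamma=0$, then $-x_0^2+x_1^2+x_2^2+x_3^2$ and $x_0^2+\beta\gamma x_1^2-\gamma x_2^2+\beta x_3^2$ belong to the center of $A(\alpha,\beta,\gamma)$.
   Context: Write $[x,y]=xy-yx$, $\{x,y\}=xy+yx$. $A(\alpha,\beta,\gamma)$ is the free algebra $\Bbbk\langle x_0,x_1,x_2,x_3\rangle$ modulo the six relations $$[x_0,x_1]=\alpha\{x_2,x_3\},\quad [x_0,x_2]=\beta\{x_3,x_1\},\quad [x_0,x_3]=\gamma\{x_1,x_2\},$$ $$\{x_0,x_1\}=[x_2,x_3],\quad \{x_0,x_2\}=[x_3,x_1],\quad \{x_0,x_3\}=[x_1,x_2].$$ *)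

(* Defs.v *)
From HB Require Import structures.
From mathcomp Require Import all_boot all_order all_algebra.
From mathcomp Require Import generic_quotient ring_quotient.
From mathcomp Require Import boolp.
From mathcomp Require Import finmap.
From mathcomp.multinomials Require Import monalg.

Set Implicit Arguments.
Unset Strict Implicit.
Unset Printing Implicit Defensive.

Import GRing.Theory.
Local Open Scope ring_scope.
Local Open Scope quotient_scope.

Section RingNotions.
Variable R : nzRingType.
Implicit Types x y z : R.

Definition commutator x y := x * y - y * x.
Definition anticommutator x y := x * y + y * x.

Definition in_center z : Prop := forall x, GRing.comm z x.

Definition two_sided_ideal (J : R -> Prop) : Prop :=
  [/\ J 0,
      forall x y, J x -> J y -> J (x - y),
      forall a x, J x -> J (a * x)
    & forall a x, J x -> J (x * a)].

Definition generated_ideal (S : R -> Prop) : {pred R} :=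
  fun x => `[< forall J, two_sided_ideal J -> (forall s, S s -> J s) -> J x >].

Lemma generated_idealP S x :
  reflect (forall J, two_sided_ideal J -> (forall s, S s -> J s) -> J x)
          (x \in generated_ideal S).
Proof. by rewrite unfold_in; apply: asboolP. Qed.

Lemma generated_ideal_gen (S : R -> Prop) s : S s -> s \in generated_ideal S.
Proof. by move=> Ss; apply/generated_idealP => J _; apply. Qed.

Lemma generated_ideal0 S : 0 \in generated_ideal S.
Proof. by apply/generated_idealP => J []. Qed.

Lemma generated_idealB S x y :
  x \in generated_ideal S -> y \in generated_ideal S ->
  x - y \in generated_ideal S.
Proof.
move=> /generated_idealP Ix /generated_idealP Iy.
apply/generated_idealP => J idJ SJ; case: (idJ) => _ JB _ _.
by apply: JB; [exact: Ix | exact: Iy].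
Qed.

Lemma generated_idealMl S a x :
  x \in generated_ideal S -> a * x \in generated_ideal S.
Proof.
move=> /generated_idealP Ix; apply/generated_idealP => J idJ SJ.
by case: (idJ) => _ _ JM _; apply: JM; exact: Ix.
Qed.

Lemma generated_idealMr S a x :
  x \in generated_ideal S -> x * a \in generated_ideal S.
Proof.
move=> /generated_idealP Ix; apply/generated_idealP => J idJ SJ.
by case: (idJ) => _ _ _ JM; apply: JM; exact: Ix.
Qed.

Lemma generated_ideal_zmod_closed S : zmod_closed (generated_ideal S).
Proof.
by split=> [|x y]; [exact: generated_ideal0 | exact: generated_idealB].
Qed.

HB.instance Definition _ S :=
  GRing.isZmodClosed.Build R (generated_ideal S)
    (generated_ideal_zmod_closed S).

End RingNotions.

Lemma generated_ideal_proper (R T : nzRingType) (f : {rmorphism R -> T})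
    (S : R -> Prop) :
  (forall s, S s -> f s = 0) -> 1 \notin generated_ideal S.
Proof.
move=> fS0; apply/generated_idealP => /(_ (fun x => f x = 0)) f1.
suff /eqP: f 1 = 0 by rewrite rmorph1 oner_eq0.
apply: f1 => //; split=> [|x y fx fy|a x fx|a x fx]; first exact: rmorph0.
- by rewrite rmorphB fx fy subrr.
- by rewrite rmorphM fx mulr0.
- by rewrite rmorphM fx mul0r.
Qed.

(* The library only makes Quotient.quot a ring for commutative base rings, and
   its algebra structures require 1 != 0; hence the properness argument. *)
Section QuotientAlgebra.
Variables (k : comNzRingType) (F : algType k) (S : F -> Prop).
Hypothesis properS : 1 \notin generated_ideal S.

Definition quotient_algebra of 1 \notin generated_ideal S : predArgType :=
  Quotient.quot (generated_ideal S).

Local Notation I := (generated_ideal S).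
Local Notation Q := (quotient_algebra properS).

HB.instance Definition _ := GRing.Zmodule.on Q.

Definition quotient_proj : F -> Q := \pi_(Quotient.quot I).
Definition quotient_repr (a : Q) : F := repr (a : Quotient.quot I).

Local Notation pi := quotient_proj.
Local Notation rep := quotient_repr.

Lemma quotient_projP p q : pi p = pi q <-> p - q \in I.
Proof. by rewrite Quotient.idealrBE; split=> /eqP. Qed.

Lemma quotient_reprK : cancel rep pi.
Proof. exact: reprK. Qed.

Lemma repr_quotient_proj p : rep (pi p) - p \in I.
Proof. by apply/quotient_projP; rewrite quotient_reprK. Qed.

Fact quotient_projD p q : pi (p + q) = pi p + pi q.
Proof. by rewrite /quotient_proj [in RHS]piE. Qed.

Fact quotient_projB : zmod_morphism pi.
Proof. by move=> p q; apply: (addIr (pi q)); rewrite -quotient_projD !subrK. Qed.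

HB.instance Definition _ := GRing.isZmodMorphism.Build F Q pi quotient_projB.

Definition quotient_mul (a b : Q) : Q := pi (rep a * rep b).
Definition quotient_scale (c : k) (a : Q) : Q := pi (c *: rep a).

Fact pi_mul p q : pi (p * q) = quotient_mul (pi p) (pi q).
Proof.
apply/esym/quotient_projP; set p' := rep _; set q' := rep _.
rewrite -[p' * q'](subrK (p' * q)) -addrA -mulrBr -mulrBl rpredD //.
  exact/generated_idealMl/repr_quotient_proj.
exact/generated_idealMr/repr_quotient_proj.
Qed.

Fact pi_scale c p : pi (c *: p) = quotient_scale c (pi p).
Proof.
apply/esym/quotient_projP; rewrite -scalerBr -mulr_algl.
exact/generated_idealMl/repr_quotient_proj.
Qed.

Fact quotient_mulA : associative quotient_mul.
Proof.
move=> a b c; rewrite -[a]quotient_reprK -[b]quotient_reprK.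
by rewrite -[c]quotient_reprK -!pi_mul mulrA.
Qed.

Fact quotient_mul1 : left_id (pi 1) quotient_mul.
Proof. by move=> a; rewrite -[a]quotient_reprK -pi_mul mul1r. Qed.

Fact quotient_mulr1 : right_id (pi 1) quotient_mul.
Proof. by move=> a; rewrite -[a]quotient_reprK -pi_mul mulr1. Qed.

Fact quotient_mulDl : left_distributive quotient_mul +%R.
Proof.
move=> a b c; rewrite -[a]quotient_reprK -[b]quotient_reprK.
by rewrite -[c]quotient_reprK -raddfD -!pi_mul -raddfD mulrDl.
Qed.

Fact quotient_mulDr : right_distributive quotient_mul +%R.
Proof.
move=> a b c; rewrite -[a]quotient_reprK -[b]quotient_reprK.
by rewrite -[c]quotient_reprK -raddfD -!pi_mul -raddfD mulrDr.
Qed.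

Fact quotient_one_neq0 : pi 1 != 0.
Proof.
apply: contra properS => /eqP pi1.
by rewrite -[1]subr0; apply/quotient_projP; rewrite pi1 raddf0.
Qed.

HB.instance Definition _ := GRing.Zmodule_isNzRing.Build Q quotient_mulA
  quotient_mul1 quotient_mulr1 quotient_mulDl quotient_mulDr quotient_one_neq0.

Fact quotient_projM : monoid_morphism pi.
Proof. by split=> // p q; exact: pi_mul. Qed.

HB.instance Definition _ := GRing.isMonoidMorphism.Build F Q pi quotient_projM.

Fact quotient_scaleA c d a :
  quotient_scale c (quotient_scale d a) = quotient_scale (c * d) a.
Proof. by rewrite -[a]quotient_reprK -!pi_scale scalerA. Qed.

Fact quotient_scale1 : left_id 1 quotient_scale.
Proof. by move=> a; rewrite -[a]quotient_reprK -pi_scale scale1r. Qed.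

Fact quotient_scaleDr : right_distributive quotient_scale +%R.
Proof.
move=> c a b; rewrite -[a]quotient_reprK -[b]quotient_reprK.
by rewrite -raddfD -!pi_scale -raddfD scalerDr.
Qed.

Fact quotient_scaleDl a : {morph quotient_scale^~ a : c d / c + d}.
Proof.
by move=> c d; rewrite -[a]quotient_reprK -!pi_scale -raddfD scalerDl.
Qed.

HB.instance Definition _ := GRing.Zmodule_isLmodule.Build k Q
  quotient_scaleA quotient_scale1 quotient_scaleDr quotient_scaleDl.

Fact quotient_projZ : scalable pi.
Proof. exact: pi_scale. Qed.

HB.instance Definition _ := GRing.isScalable.Build k F Q *:%R pi quotient_projZ.

Fact quotient_scaleAl (c : k) (a b : Q) : c *: (a * b) = (c *: a) * b.
Proof.
rewrite -[a]quotient_reprK -[b]quotient_reprK.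
by rewrite -rmorphM -!quotient_projZ -rmorphM scalerAl.
Qed.

HB.instance Definition _ := GRing.Lmodule_isLalgebra.Build k Q quotient_scaleAl.

Fact quotient_scaleAr (c : k) (a b : Q) : c *: (a * b) = a * (c *: b).
Proof.
rewrite -[a]quotient_reprK -[b]quotient_reprK.
by rewrite -rmorphM -!quotient_projZ -rmorphM scalerAr.
Qed.

HB.instance Definition _ := GRing.Lalgebra_isAlgebra.Build k Q quotient_scaleAr.

End QuotientAlgebra.

Section FreeAlgebra.
Variables (k : fieldType) (n : nat).
Local Notation M := {fmonom 'I_n}.

Lemma malgC_comm (c : k) (p : {malg k[M]}) : c%:MP * p = p * c%:MP.
Proof.
rewrite !malgM_def /malgC fgmulUg fgmulgU; apply: eq_bigr => m _.
by rewrite mulrC mul1m mulm1.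
Qed.

Lemma malg_scalerAr (c : k) (p q : {malg k[M]}) : c *: (p * q) = p * (c *: q).
Proof. by rewrite -!mul_malgC [LHS]mulrA malgC_comm -[LHS]mulrA. Qed.

Definition free_algebra : predArgType := {malg k[M]}.

HB.instance Definition _ := GRing.Lalgebra.on free_algebra.
HB.instance Definition _ :=
  GRing.Lalgebra_isAlgebra.Build k free_algebra malg_scalerAr.

Definition free_gen (i : 'I_n) : free_algebra := << fmu i >>.

Definition augmentation (p : free_algebra) : k := mcoeff mone p.

Fact augmentationB : zmod_morphism augmentation.
Proof. exact: mcoeffB. Qed.

Fact augmentationM : monoid_morphism augmentation.
Proof. by split; [exact: (rmorph1 (mcoeff mone)) | exact: (rmorphM (mcoeff mone))]. Qed.

HB.instance Definition _ :=
  GRing.isZmodMorphism.Build free_algebra k augmentation augmentationB.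
HB.instance Definition _ :=
  GRing.isMonoidMorphism.Build free_algebra k augmentation augmentationM.

Lemma augmentation_gen i : augmentation (free_gen i) = 0.
Proof.
rewrite /augmentation mcoeffU1; case: eqP => //= /(congr1 (@fmonom_val _)).
by rewrite fmuE fm1.
Qed.

End FreeAlgebra.

Section AlgebraA.
Variables (k : fieldType) (alpha beta gamma : k).

(* Each relation u = v is recorded as u - v. *)
Definition A_relations (F : algType k) (x : 'I_4 -> F) : seq F :=
  let: (x0, x1, x2, x3) := (x 0, x 1, x 2%:R, x 3%:R) in
  [:: commutator x0 x1 - alpha *: anticommutator x2 x3;
      commutator x0 x2 - beta *: anticommutator x3 x1;
      commutator x0 x3 - gamma *: anticommutator x1 x2;
      anticommutator x0 x1 - commutator x2 x3;
      anticommutator x0 x2 - commutator x3 x1;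
      anticommutator x0 x3 - commutator x1 x2].

Lemma A_relations_augmentation (F : algType k) (x : 'I_4 -> F)
    (f : {rmorphism F -> k}) :
  (forall i, f (x i) = 0) -> forall r, r \in A_relations x -> f r = 0.
Proof.
move=> fx0.
have fC y z : f y = 0 -> f (commutator y z) = 0.
  by move=> fy; rewrite rmorphB !rmorphM fy mul0r mulr0 subr0.
have fA y z : f y = 0 -> f (anticommutator y z) = 0.
  by move=> fy; rewrite rmorphD !rmorphM fy mul0r mulr0 addr0.
have fZ (c : k) y : f y = 0 -> f (c *: y) = 0.
  by move=> fy; rewrite -mulr_algl rmorphM fy mulr0.
move=> r; rewrite /A_relations !inE; do 5?[case/predU1P=> [->|]]; last move/eqP->.
1-3: by rewrite rmorphB (fC _ _ (fx0 _)) (fZ _ _ (fA _ _ (fx0 _))) subr0.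
all: by rewrite rmorphB (fC _ _ (fx0 _)) (fA _ _ (fx0 _)) subr0.
Qed.

Lemma A_relations_map (F G : algType k) (f : {lrmorphism F -> G})
    (x : 'I_4 -> F) :
  map f (A_relations x) = A_relations (f \o x).
Proof.
have fC (y z : F) : f (commutator y z) = commutator (f y) (f z).
  by rewrite rmorphB !rmorphM.
have fA (y z : F) : f (anticommutator y z) = anticommutator (f y) (f z).
  by rewrite rmorphD !rmorphM.
have fCA d (y z y' z' : F) : f (commutator y z - d *: anticommutator y' z')
    = commutator (f y) (f z) - d *: anticommutator (f y') (f z').
  by rewrite raddfB /= linearZ /= fC fA.
have fAC (y z y' z' : F) : f (anticommutator y z - commutator y' z')
    = anticommutator (f y) (f z) - commutator (f y') (f z').
  by rewrite raddfB /= fC fA.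
by rewrite /A_relations /= !fCA !fAC.
Qed.

Lemma A_proper :
  1 \notin generated_ideal (fun r => r \in A_relations (@free_gen k 4)).
Proof.
apply: (@generated_ideal_proper _ _ (@augmentation k 4)).
exact/A_relations_augmentation/augmentation_gen.
Qed.

Definition algebra_A : algType k := quotient_algebra A_proper.

Definition A_gen (i : 'I_4) : algebra_A := quotient_proj A_proper (free_gen k i).

Lemma A_gen_relations r : r \in A_relations A_gen -> r = 0.
Proof.
rewrite -(A_relations_map (quotient_proj A_proper) (@free_gen k 4)).
case/mapP => s hs ->.
rewrite -(raddf0 (quotient_proj A_proper)); apply/quotient_projP.
by rewrite subr0; apply: generated_ideal_gen.
Qed.

End AlgebraA.

(* Main.v *)
Require Import Defs.
From mathcomp Require Import all_boot all_order all_algebra.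
From mathcomp Require Import ring.
From mathcomp.multinomials Require Import monalg.

Set Implicit Arguments.
Unset Strict Implicit.
Unset Printing Implicit Defensive.

Import GRing.Theory.
Local Open Scope ring_scope.

(** Two ways of writing the commutator with a square carry the proof:
    [a^2, b] = [a, {a, b}] = {a, [a, b]}. Each defining relation of the algebra
    turns the inner bracket into another one, so that [x_i^2, x_j] becomes a
    nested bracket, and nested brackets are related by the Jacobi identity and
    by its analogue {a, {b, c}} = [[a, b], c] + {b, {a, c}}.

    This gives two linear relations between the commutators of x_0^2, x_2^2 and
    x_3^2 with x_1, namely
      [x_0^2, x_1] = [x_2^2, x_1] + [x_3^2, x_1]               (unweighted) and
      [x_0^2, x_1] = gamma [x_2^2, x_1] - beta [x_3^2, x_1]    (weighted),
    and two more between the commutators of x_1^2, x_2^2 and x_3^2 with x_0. The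
    relations of the algebra are stable under the cyclic substitution
    x_1 -> x_2 -> x_3 -> x_1, alpha -> beta -> gamma -> alpha, so analogues with
    x_2 and x_3 in place of x_1 hold too.

    The first quadratic element, Omega1, is invariant under this rotation, and
    the unweighted relations say that it commutes with every generator.
    The second one, Omega2, is not invariant. That it commutes with x_0 and x_1
    is exactly a weighted relation. For x_2 (and likewise x_3),
    the unweighted and the weighted relation together eliminate x_0 and make
    p = [x_1^2, x_2] and q = [x_3^2, x_2] proportional:
    (1 + gamma) p = (alpha - 1) q. The commutator of Omega2 with x_2 is a
    combination of p and q; multiplied by the invertible scalar 1 + gamma it
    becomes (alpha + beta + gamma + alpha beta gamma) q = 0.

    Finally, an element commuting with the four generators is central because
    words in the generators span the algebra. *)

Local Notation "⟦ x , y ⟧" := (commutator x y)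
  (at level 0, x at level 99, y at level 99).
Local Notation "⦃ x , y ⦄" := (anticommutator x y)
  (at level 0, x at level 99, y at level 99).

(** * Nested commutators and anticommutators *)

Section RingIdentities.
Variable R : nzRingType.
Implicit Types a b c : R.

Lemma commutatorC a b : ⟦a, b⟧ = - ⟦b, a⟧.
Proof. by rewrite /commutator opprB. Qed.

Lemma anticommutatorC a b : ⦃a, b⦄ = ⦃b, a⦄.
Proof. by rewrite /anticommutator addrC. Qed.

Lemma commutatorDl a b c : ⟦a + b, c⟧ = ⟦a, c⟧ + ⟦b, c⟧.
Proof. by rewrite /commutator mulrDl mulrDr opprD addrACA. Qed.

Lemma commutatorNl a b : ⟦- a, b⟧ = - ⟦a, b⟧.
Proof. by rewrite /commutator mulNr mulrN opprB opprK addrC. Qed.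

Lemma commutatorBr a b c : ⟦a, b - c⟧ = ⟦a, b⟧ - ⟦a, c⟧.
Proof.
by rewrite /commutator mulrBl mulrBr !opprB addrACA [- _ - _]addrC addrACA.
Qed.

Lemma commutatorNr a b : ⟦a, - b⟧ = - ⟦a, b⟧.
Proof. by rewrite /commutator mulNr mulrN opprB opprK addrC. Qed.

Lemma anticommutatorDr a b c : ⦃a, b + c⦄ = ⦃a, b⦄ + ⦃a, c⦄.
Proof. by rewrite /anticommutator mulrDl mulrDr addrACA. Qed.

Lemma anticommutatorNr a b : ⦃a, - b⦄ = - ⦃a, b⦄.
Proof. by rewrite /anticommutator mulNr mulrN opprD. Qed.

Lemma commutator_sqr_self a : ⟦a ^+ 2, a⟧ = 0.
Proof. by rewrite /commutator -exprSr -exprS subrr. Qed.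

Lemma commutator_sqr a b : ⟦a ^+ 2, b⟧ = ⟦a, ⦃a, b⦄⟧.
Proof.
by rewrite /commutator /anticommutator expr2 mulrDr mulrDl !mulrA addrKA.
Qed.

Lemma commutator_sqr_anti a b : ⟦a ^+ 2, b⟧ = ⦃a, ⟦a, b⟧⦄.
Proof.
by rewrite /commutator /anticommutator expr2 mulrBr mulrBl !mulrA addrA subrK.
Qed.

Lemma commutatorMr a b c : ⟦a, b * c⟧ = ⟦a, b⟧ * c + b * ⟦a, c⟧.
Proof. by rewrite /commutator mulrBr mulrBl !mulrA addrA subrK. Qed.

Lemma Jacobi a b c : ⟦a, ⟦b, c⟧⟧ = ⟦⟦a, b⟧, c⟧ + ⟦b, ⟦a, c⟧⟧.
Proof.
rewrite -[commutator b c]/(b * c - c * b) commutatorBr !commutatorMr.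
by rewrite opprD [- _ - _]addrC addrACA.
Qed.

(** Leibniz rules for the anticommutator abc + bca: subtracting and adding bac
    gives this one, adding and subtracting bac gives the next. *)
Lemma anticommutatorMrl a b c : ⦃a, b * c⦄ = ⟦a, b⟧ * c + b * ⦃a, c⦄.
Proof. by rewrite /commutator /anticommutator mulrDr mulrBl !mulrA addrA subrK. Qed.

Lemma anticommutatorMrr a b c : ⦃a, b * c⦄ = ⦃a, b⦄ * c - b * ⟦a, c⟧.
Proof.
rewrite /commutator /anticommutator mulrBr mulrDl !mulrA opprB.
by rewrite [b * c * a - _]addrC addrA addrK.
Qed.

(** Analogue of the Jacobi identity: expand {a, bc} by the first Leibniz rule
    and {a, cb} by the second, so that both times a commutator falls on b and an
    anticommutator on c. *)
Lemma anticommutator_nested a b c :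
  ⦃a, ⦃b, c⦄⦄ = ⟦⟦a, b⟧, c⟧ + ⦃b, ⦃a, c⦄⦄.
Proof.
rewrite -[anticommutator b c]/(b * c + c * b) anticommutatorDr.
by rewrite anticommutatorMrl anticommutatorMrr [_ * b - _]addrC addrACA.
Qed.

End RingIdentities.

Section AlgebraIdentities.
Variables (k : fieldType) (F : algType k).
Implicit Types (c : k) (a b : F).

Lemma commutatorZl c a b : ⟦c *: a, b⟧ = c *: ⟦a, b⟧.
Proof. by rewrite /commutator -scalerAl -scalerAr scalerBr. Qed.

Lemma commutatorZr c a b : ⟦a, c *: b⟧ = c *: ⟦a, b⟧.
Proof. by rewrite /commutator -scalerAl -scalerAr scalerBr. Qed.

Lemma anticommutatorZr c a b : ⦃a, c *: b⦄ = c *: ⦃a, b⦄.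
Proof. by rewrite /anticommutator -scalerAl -scalerAr scalerDr. Qed.

Lemma comm_scaler c a b : GRing.comm a b -> GRing.comm a (c *: b).
Proof. by move=> ab; rewrite /GRing.comm -scalerAr -scalerAl ab. Qed.

End AlgebraIdentities.

(** * Commutators of squares under the defining relations *)

Section Quadruples.
Variables (k : fieldType) (F : algType k).
Implicit Types (alpha beta gamma : k) (x y : F).

(** The defining relations with the four elements as separate arguments, so that
    cyclic rotation of the last three is a mere permutation of arguments. *)
Definition A_quadruple alpha beta gamma x0 x1 x2 x3 : Prop :=
  [/\ ⟦x0, x1⟧ = alpha *: ⦃x2, x3⦄,
      ⟦x0, x2⟧ = beta *: ⦃x3, x1⦄ &
      ⟦x0, x3⟧ = gamma *: ⦃x1, x2⦄] /\
  [/\ ⦃x0, x1⦄ = ⟦x2, x3⟧,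
      ⦃x0, x2⦄ = ⟦x3, x1⟧ &
      ⦃x0, x3⦄ = ⟦x1, x2⟧].

Lemma A_quadruple_rotate alpha beta gamma x0 x1 x2 x3 :
  A_quadruple alpha beta gamma x0 x1 x2 x3 ->
  A_quadruple beta gamma alpha x0 x2 x3 x1.
Proof. by move=> [[? ? ?] [? ? ?]]. Qed.

(** Since {x0, x1} = [x2, x3], the left side is [x0, [x2, x3]], and the
    analogue of the Jacobi identity splits this nested commutator into the two
    nested anticommutators {x3, {x0, x2}} and - {x2, {x0, x3}}. *)
Lemma commutator_sqr0_sum alpha beta gamma x0 x1 x2 x3 :
  A_quadruple alpha beta gamma x0 x1 x2 x3 ->
  ⟦x0 ^+ 2, x1⟧ = ⟦x2 ^+ 2, x1⟧ + ⟦x3 ^+ 2, x1⟧.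
Proof.
move=> [_ [E1 E2 E3]].
rewrite commutator_sqr E1 2!commutator_sqr_anti.
rewrite (commutatorC x2 x1) -E2 -E3 anticommutatorNr.
rewrite (anticommutatorC x0 x2) (anticommutator_nested x3).
rewrite (anticommutatorC x3 x0) addrC addrK.
by rewrite commutatorC -commutatorNl -commutatorC.
Qed.

(** The same [x0, [x2, x3]] is now split by the Jacobi identity into
    brackets containing [x0, x2] and [x0, x3], which bring in the weights. *)
Lemma commutator_sqr0_weighted alpha beta gamma x0 x1 x2 x3 :
  A_quadruple alpha beta gamma x0 x1 x2 x3 ->
  ⟦x0 ^+ 2, x1⟧ = gamma *: ⟦x2 ^+ 2, x1⟧ - beta *: ⟦x3 ^+ 2, x1⟧.
Proof.
move=> [[_ C2 C3] [E1 _ _]].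
rewrite commutator_sqr E1 Jacobi C2 C3 commutatorZl commutatorZr.
rewrite (commutatorC ⦃x3, x1⦄) scalerN addrC.
by rewrite (anticommutatorC x1 x2) -!commutator_sqr.
Qed.

(** Since [xi^2, x0] = [xi, {x0, xi}], the three terms are those of the
    cyclic form of the Jacobi identity for x1, x2, x3. *)
Lemma commutator_sqr_x0_sum alpha beta gamma x0 x1 x2 x3 :
  A_quadruple alpha beta gamma x0 x1 x2 x3 ->
  ⟦x1 ^+ 2, x0⟧ + ⟦x2 ^+ 2, x0⟧ + ⟦x3 ^+ 2, x0⟧ = 0.
Proof.
move=> [_ [E1 E2 E3]].
rewrite 3!commutator_sqr !(anticommutatorC _ x0) E1 E2 E3.
rewrite Jacobi (commutatorC ⟦x1, x2⟧ x3) (commutatorC x1 x3).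
by rewrite commutatorNr -addrA -addrA [X in _ + X]addrA addNr add0r addNr.
Qed.

(** The last two terms contain {x2, {x3, x1}} and {x3, {x1, x2}} with opposite
    coefficients; their difference is [[x2, x3], x1], which cancels
    [x1^2, x0] = [x1, [x2, x3]]. *)
Lemma commutator_sqr_x0_weighted alpha beta gamma x0 x1 x2 x3 :
  A_quadruple alpha beta gamma x0 x1 x2 x3 ->
  (beta * gamma) *: ⟦x1 ^+ 2, x0⟧ - gamma *: ⟦x2 ^+ 2, x0⟧
    + beta *: ⟦x3 ^+ 2, x0⟧ = 0.
Proof.
move=> [[_ C2 C3] [E1 _ _]].
have -> : ⟦x2 ^+ 2, x0⟧ = - beta *: ⦃x2, ⦃x3, x1⦄⦄.
  by rewrite commutator_sqr_anti commutatorC C2 -scaleNr anticommutatorZr.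
have -> : ⟦x3 ^+ 2, x0⟧ = - gamma *: ⦃x3, ⦃x1, x2⦄⦄.
  by rewrite commutator_sqr_anti commutatorC C3 -scaleNr anticommutatorZr.
rewrite (anticommutator_nested x2) (anticommutatorC x2 x1).
rewrite commutator_sqr (anticommutatorC x1 x0) E1.
rewrite (commutatorC ⟦x2, x3⟧ x1) !scalerA mulrN mulrN scaleNr opprK.
by rewrite scaleNr [gamma * _]mulrC -scalerDr addrA subrr add0r subrr.
Qed.

(** * The two quadratic elements commute with the generators *)

Definition Omega1 x0 x1 x2 x3 : F := - x0 ^+ 2 + x1 ^+ 2 + x2 ^+ 2 + x3 ^+ 2.

Definition Omega2 beta gamma x0 x1 x2 x3 : F :=
  x0 ^+ 2 + (beta * gamma) *: x1 ^+ 2 - gamma *: x2 ^+ 2 + beta *: x3 ^+ 2.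

Lemma Omega1_x0 alpha beta gamma x0 x1 x2 x3 :
  A_quadruple alpha beta gamma x0 x1 x2 x3 ->
  ⟦Omega1 x0 x1 x2 x3, x0⟧ = 0.
Proof.
move=> /commutator_sqr_x0_sum x0_sum.
rewrite !commutatorDl commutatorNl commutator_sqr_self oppr0 add0r.
exact: x0_sum.
Qed.

Lemma Omega1_x1 alpha beta gamma x0 x1 x2 x3 :
  A_quadruple alpha beta gamma x0 x1 x2 x3 ->
  ⟦Omega1 x0 x1 x2 x3, x1⟧ = 0.
Proof.
move=> /commutator_sqr0_sum x1_sum.
rewrite !commutatorDl commutatorNl commutator_sqr_self addr0 -addrA x1_sum.
exact: addNr.
Qed.

Lemma Omega1_rotate x0 x1 x2 x3 : Omega1 x0 x2 x3 x1 = Omega1 x0 x1 x2 x3.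
Proof. by rewrite /Omega1 -!addrA [x2 ^+ 2 + _]addrA [_ + x1 ^+ 2]addrC. Qed.

Lemma commutator_Omega2 beta gamma x0 x1 x2 x3 y :
  ⟦Omega2 beta gamma x0 x1 x2 x3, y⟧ =
    ⟦x0 ^+ 2, y⟧ + (beta * gamma) *: ⟦x1 ^+ 2, y⟧
      - gamma *: ⟦x2 ^+ 2, y⟧ + beta *: ⟦x3 ^+ 2, y⟧.
Proof. by rewrite !commutatorDl commutatorNl !commutatorZl. Qed.

Lemma Omega2_x0 alpha beta gamma x0 x1 x2 x3 :
  A_quadruple alpha beta gamma x0 x1 x2 x3 ->
  ⟦Omega2 beta gamma x0 x1 x2 x3, x0⟧ = 0.
Proof.
move=> /commutator_sqr_x0_weighted x0_weighted.
by rewrite commutator_Omega2 commutator_sqr_self add0r.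
Qed.

Lemma Omega2_x1 alpha beta gamma x0 x1 x2 x3 :
  A_quadruple alpha beta gamma x0 x1 x2 x3 ->
  ⟦Omega2 beta gamma x0 x1 x2 x3, x1⟧ = 0.
Proof.
move=> /commutator_sqr0_weighted x1_weighted.
rewrite commutator_Omega2 x1_weighted commutator_sqr_self scaler0 addr0.
by rewrite -addrA [- _ + beta *: _]addrC subrKA subrr.
Qed.

(** The coefficients of Omega2 single out x1, so rotation does not reduce this
    case to that of x1: here the relation between the parameters enters. *)
Lemma Omega2_x2 alpha beta gamma x0 x1 x2 x3 :
  gamma != -1 -> alpha + beta + gamma + alpha * beta * gamma = 0 ->
  A_quadruple alpha beta gamma x0 x1 x2 x3 ->
  ⟦Omega2 beta gamma x0 x1 x2 x3, x2⟧ = 0.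
Proof.
move=> gammaN1 sum0 /A_quadruple_rotate A_x.
have := commutator_sqr0_weighted A_x; have sqr0E := commutator_sqr0_sum A_x.
rewrite commutator_Omega2 commutator_sqr_self scaler0 subr0 {}sqr0E.
set p := ⟦x1 ^+ 2, x2⟧; set q := ⟦x3 ^+ 2, x2⟧.
move=> pq_eq.
have gamma1_neq0 : 1 + gamma != 0 by rewrite addrC addr_eq0.
(* The two expressions of [x0^2, x2] compared. *)
have pq : (1 + gamma) *: p = (alpha - 1) *: q.
  have alpha_q : alpha *: q = q + p + gamma *: p by rewrite pq_eq subrK.
  by rewrite scalerBl alpha_q scalerDl !scale1r -(addrA q) [RHS]addrC addKr.
apply: (scalerI gamma1_neq0); rewrite scaler0.
have -> : q + p + (beta * gamma) *: p + beta *: q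
    = (1 + beta * gamma) *: p + (1 + beta) *: q.
  by rewrite !scalerDl !scale1r [RHS]addrACA [p + q]addrC !addrA.
rewrite scalerDr !scalerA [(1 + gamma) * (1 + beta * gamma)]mulrC.
rewrite -(scalerA (1 + beta * gamma)) pq.
rewrite scalerA -scalerDl.
suff -> : (1 + beta * gamma) * (alpha - 1) + (1 + gamma) * (1 + beta) = 0.
  exact: scale0r.
by rewrite -[RHS]sum0; ring.
Qed.

Lemma Omega2_x3 alpha beta gamma x0 x1 x2 x3 :
  beta != 1 -> alpha + beta + gamma + alpha * beta * gamma = 0 ->
  A_quadruple alpha beta gamma x0 x1 x2 x3 ->
  ⟦Omega2 beta gamma x0 x1 x2 x3, x3⟧ = 0.
Proof.
move=> beta1 sum0 /A_quadruple_rotate/A_quadruple_rotate A_x.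
have := commutator_sqr0_weighted A_x; have sqr0E := commutator_sqr0_sum A_x.
rewrite commutator_Omega2 commutator_sqr_self scaler0 addr0 {}sqr0E.
set p := commutator (x1 ^+ 2) x3; set q := commutator (x2 ^+ 2) x3.
move=> pq_eq.
have beta1_neq0 : beta - 1 != 0 by rewrite subr_eq0.
(* The two expressions of [x0^2, x3] compared. *)
have pq : (beta - 1) *: p = (1 + alpha) *: q.
  have beta_p : beta *: p = p + q + alpha *: q by rewrite pq_eq subrK.
  by rewrite scalerBl beta_p scalerDl !scale1r -(addrA p) [LHS]addrC addKr.
apply: (scalerI beta1_neq0); rewrite scaler0.
have -> : p + q + (beta * gamma) *: p - gamma *: q
    = (1 + beta * gamma) *: p + (1 - gamma) *: q.
  by rewrite scalerDl scalerBl !scale1r [RHS]addrACA !addrA.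
rewrite scalerDr !scalerA [(beta - 1) * (1 + _)]mulrC.
rewrite -(scalerA (1 + beta * gamma)) pq.
rewrite scalerA -scalerDl.
suff -> : (1 + beta * gamma) * (1 + alpha) + (beta - 1) * (1 - gamma) = 0.
  exact: scale0r.
by rewrite -[RHS]sum0; ring.
Qed.

End Quadruples.

(** * The generators span the algebra multiplicatively *)

Lemma malgU_scale (K : choiceType) (R : nzRingType) (c : R) (w : K) :
  << c *g w >> = c *: << w >> :> {malg R[K]}.
Proof. by apply/malgP => m; rewrite fgscaleE !mcoeffU mulrnAr mulr1. Qed.

Lemma free_algebra_word (k : fieldType) (n : nat) (w : {fmonom 'I_n}) :
  << w >> = \prod_(i <- w) free_gen k i :> free_algebra k n.
Proof.
case: w; elim=> [|i w IHw] /=; first by rewrite big_nil -fmoneE.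
rewrite big_cons -IHw [RHS]malgM_def fgmulUU mulr1; congr << 1 *g _ >>.
by apply/eqP; rewrite fmP fmM fmU.
Qed.

(** The centralizer of z is a subalgebra, and the algebra is spanned by the
    images of the words. *)
Lemma in_center_A (k : fieldType) (alpha beta gamma : k)
    (z : algebra_A alpha beta gamma) :
  (forall i, ⟦z, A_gen alpha beta gamma i⟧ = 0) -> in_center z.
Proof.
move=> z_gen a; rewrite -[a]quotient_reprK.
move: (quotient_repr a) => p.
rewrite [p]monalgE raddf_sum; apply: commr_sum => w _.
(* Restores the morphism, which raddf_sum leaves as a bare additive map. *)
rewrite -[_ << _ *g w >>]/(quotient_proj _ _) malgU_scale linearZ.
rewrite free_algebra_word rmorph_prod.
apply: comm_scaler; apply: commr_prod => i _.
by apply: subr0_eq; apply: z_gen.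
Qed.

Theorem proposition6p1 (k : fieldType) (alpha beta gamma : k)
    (Hnot01 : {in [:: alpha; beta; gamma], forall t, t \notin [:: 0; 1; -1]})
    (Hsum : alpha + beta + gamma + alpha * beta * gamma = 0) :
  let x : 'I_4 -> algebra_A alpha beta gamma := A_gen alpha beta gamma in
  in_center (- x 0 ^+ 2 + x 1 ^+ 2 + x 2%:R ^+ 2 + x 3%:R ^+ 2) /\
  in_center (x 0 ^+ 2 + (beta * gamma) *: x 1 ^+ 2
             - gamma *: x 2%:R ^+ 2 + beta *: x 3%:R ^+ 2).
Proof.
move=> x.
have A_x : A_quadruple alpha beta gamma (x 0) (x 1) (x 2%:R) (x 3%:R).
  have rel0 (j : 'I_6) : (A_relations alpha beta gamma x)`_j = 0.
    by apply: A_gen_relations; apply: mem_nth.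
  by split; split; apply: subr0_eq;
    [exact: (rel0 0) | exact: (rel0 1) | exact: (rel0 2%:R)
    |exact: (rel0 3%:R) | exact: (rel0 4%:R) | exact: (rel0 5%:R)].
have beta1 : beta != 1.
  have := Hnot01 beta; rewrite !inE eqxx orbT => /(_ isT).
  by rewrite !negb_or => /and3P[].
have gammaN1 : gamma != -1.
  have := Hnot01 gamma; rewrite !inE eqxx !orbT => /(_ isT).
  by rewrite !negb_or => /and3P[].
have ordE (i : 'I_4) : [|| i == 0, i == 1, i == 2%:R | i == 3%:R].
  by case: i => [[|[|[|[|?]]]] ?].
split; apply: in_center_A => i; rewrite -[A_gen _ _ _]/x.
- rewrite -/(Omega1 (x 0) (x 1) (x 2%:R) (x 3%:R)).
  case/or4P: (ordE i) => /eqP->; first exact: Omega1_x0 A_x.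
  + exact: Omega1_x1 A_x.
  + by rewrite -Omega1_rotate; exact: Omega1_x1 (A_quadruple_rotate A_x).
  + rewrite -2!Omega1_rotate.
    exact: Omega1_x1 (A_quadruple_rotate (A_quadruple_rotate A_x)).
- rewrite -/(Omega2 beta gamma (x 0) (x 1) (x 2%:R) (x 3%:R)).
  case/or4P: (ordE i) => /eqP->; first exact: Omega2_x0 A_x.
  + exact: Omega2_x1 A_x.
  + exact: Omega2_x2 A_x.
  + exact: Omega2_x3 A_x.
Qed.
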